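(* A finite soluble group $G$ is supersoluble if and only if $G$ has a normal subgroup $E$ with $G/E$ supersoluble such that every maximal subgroup of every Sylow subgroup of $F(E)$ is $\mathfrak U_\tau$-supplemented in $G$ for some $\Phi$-regular (inductive) subgroup functor $\tau$.
   Context: All groups are finite; $\mathfrak U$ is the class of supersoluble groups and $F(E)$ the Fitting subgroup. For a class $\mathfrak F$, a chief factor $H/K$ of $G$ is $\mathfrak F$-central if $(H/K)\rtimes(G/C_G(H/K))\in\mathfrak F$; $Z_{\mathfrak F}(G)$ is the product of all normal subgroups $N$ of $G$ such that every chief factor of $G$ below $N$ is $\mathfrak F$-central. For $K\le H\le G$, the pair $(K,H)$ satisfies the $\mathfrak F$-supplement condition in $G$ if there is $T\le G$ with $HT=G$ and $H\cap T\subseteq KZ_{\mathfrak F}(T)$. A subgroup functor $\tau$ assigns to each group $G$ a set $\tau(G)$ of subgroups with $1\in\tau(G)$ and $\theta(\tau(G))=\tau(\theta(G))$ for all isomorphisms $\theta:G\to G^*$; members are $\tau$-subgroups. $\tau$ is inductive if $HN/N\in\tau(G/N)$ whenever $H\in\tau(G)$, $N\trianglelefteq G$; $\Phi$-regular if for every primitive group $G$ (a group having a maximal subgroup with trivial core), whenever $H\in\tau(G)$ is a $p$-group and $N$ is a minimal normal subgroup of $G$, $|G:N_G(H\cap N)|$ is a power of $p$. With $H_G$ the core of $H$, $H$ is $\mathfrak F_\tau$-supplemented in $G$ if for some $\tau$-subgroup $\bar S$ of $G/H_G$ with $\bar S\le H/H_G$ the pair $(\bar S,H/H_G)$ satisfies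 the $\mathfrak F$-supplement condition in $G/H_G$. *)

(* Defs.v *)
From HB Require Import structures.
From mathcomp Require Import all_boot all_fingroup all_solvable.
From Stdlib Require Import ClassicalEpsilon.
Set Implicit Arguments. Unset Strict Implicit. Unset Printing Implicit Defensive.
Local Open Scope group_scope.

Definition pbool (P : Prop) : bool :=
  if excluded_middle_informative P then true else false.

Definition supersoluble (gT : finGroupType) (G : {group gT}) : Prop :=
  exists s : seq {group gT},
    [/\ path (fun A B : {group gT} => (A \subset B) && cyclic (B / A)) 1%G s,
        last 1%G s = G & all (fun A : {group gT} => A <| G) s].

Definition chief_factor (gT : finGroupType) (T H K : {group gT}) : bool :=
  [&& K <| T, H <| T, K \subset H & minnormal (H / K) (T / K)].

(* The image of T in Aut(H/K) induced by conjugation; it is isomorphic to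
   T / C_T(H/K). *)
Definition conj_aut_image (gT : finGroupType) (T H K : {group gT})
  : {set {perm coset_of K}} :=
  restr_perm (H / K) @* (actperm ('J / K)%act @* T).

(* The semidirect product (H/K) x| (T / C_T(H/K)), realised as the internal
   subgroup (H/K) x| A of the external semidirect product (H/K) x| Aut(H/K),
   where A is the image of T in Aut(H/K). *)
Definition chief_sdprod (gT : finGroupType) (T H K : {group gT}) :=
  ((sdpair1 [Aut (H / K)%G]%gact @* (H / K)%G)
     <*> (sdpair2 [Aut (H / K)%G]%gact @* conj_aut_image T H K))%G.

Definition U_central (gT : finGroupType) (T H K : {group gT}) : Prop :=
  supersoluble (chief_sdprod T H K).

Definition ZU (gT : finGroupType) (T : {group gT}) : {set gT} :=
  <<\bigcup_(N : {group gT} | (N <| T) &&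
       pbool (forall H K : {group gT},
                chief_factor T H K -> H \subset N -> U_central T H K)) N>>.

Definition U_supplement_cond (gT : finGroupType) (K H G : {set gT}) : Prop :=
  exists T : {group gT},
    [/\ T \subset G, H * T = G & H :&: T \subset K * ZU T].

Definition sgfun := forall gT : finGroupType, {group gT} -> {set {group gT}}.

Definition is_subgroup_functor (tau : sgfun) : Prop :=
  [/\ (forall (gT : finGroupType) (G : {group gT}), 1%G \in tau gT G),
      (forall (gT : finGroupType) (G H : {group gT}),
          H \in tau gT G -> H \subset G) &
      (forall (gT rT : finGroupType) (G : {group gT}) (G' : {group rT})
              (f : {morphism G >-> rT}),
          isom G G' f -> forall H : {group gT}, H \subset G ->
          ((f @* H)%G \in tau rT G') = (H \in tau gT G))].

Definition inductive_sgfun (tau : sgfun) : Prop :=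
  forall (gT : finGroupType) (G N H : {group gT}),
    H \in tau gT G -> N <| G -> ((H <*> N) / N)%G \in tau _ (G / N)%G.

Definition primitive_group (gT : finGroupType) (G : {group gT}) : Prop :=
  exists M : {group gT}, maximal M G /\ gcore M G = 1.

Definition Phi_regular (tau : sgfun) : Prop :=
  forall (gT : finGroupType) (G : {group gT}), primitive_group G ->
  forall (p : nat) (H N : {group gT}), prime p ->
    H \in tau gT G -> p.-group H -> minnormal N G ->
    p.-nat #|G : 'N_G(H :&: N)|.

Definition U_tau_supplemented (tau : sgfun) (gT : finGroupType)
  (H G : {group gT}) : Prop :=
  exists S : {group coset_of (gcore H G)},
    [/\ S \in tau _ (G / gcore H G)%G, S \subset H / gcore H G &
        U_supplement_cond S (H / gcore H G) (G / gcore H G)].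

(* Main.v *)
(* A maximal subgroup X not containing F(E) fails to contain some Sylow
   p-subgroup P of F(E), and N = P / (P :&: X) is a minimal normal subgroup complemented in
   Q = G / (P :&: X).  Pick M maximal in N and normal in a Sylow p-subgroup of Q.
   A supplement T of M in Q contains N, hence is Q itself, so either N lies in
   Z_U(Q) or M is a tau-subgroup; in the latter case Phi-regularity, applied to
   the primitive quotient of Q by the core of a complement, makes M normal in Q.
   Either way N, and so G : X, has prime order.  This also gives
   [F(E), G'] <= F(E) :&: Phi(G), whence [E, G] <= F(E), so that the maximal
   subgroups containing F(E) have prime index too; conclude by Huppert's theorem
   that a soluble group whose maximal subgroups have prime index is supersoluble. *)
Require Import Defs.
From HB Require Import structures.
From mathcomp Require Import all_boot all_fingroup all_solvable.
From mathcomp Require Import ssralg poly matrix mxalgebra mxpoly zmodp finfield.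
From mathcomp Require Import mxrepresentation mxabelem.
From Stdlib Require ClassicalEpsilon.
Set Implicit Arguments. Unset Strict Implicit. Unset Printing Implicit Defensive.
Local Open Scope group_scope.

(** * Supersoluble groups: quotients, extensions, minimal normal and maximal subgroups *)

(** A generator of [B] over [A] can be pushed to a quotient or lifted from it directly, so cyclic
    factors of a series are handled in this form. *)
Lemma cyclic_quotientP (gT : finGroupType) (A B : {group gT}) :
  A <| B -> reflect (exists2 x, x \in B & B :=: A <*> <[x]>) (cyclic (B / A)).
Proof.
case/andP=> sAB nAB; apply: (iffP cyclicP) => [[u Du] | [x Bx DB]].
  have /morphimP[x nAx Bx Dx] : u \in B / A by rewrite Du cycle_id.
  exists x => //; apply: (@quotient_inj _ A).
  - by rewrite /normal sAB.
  - by rewrite /normal joing_subl join_subG normG cycle_subG.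
  - by rewrite Du /= quotientYidl ?quotient_cycle ?Dx ?cycle_subG.
exists (coset A x); have nAx := subsetP nAB x Bx.
by rewrite DB quotientYidl ?quotient_cycle ?cycle_subG.
Qed.

Section Quotients.
Variable gT : finGroupType.
Implicit Types G H K N P M A B X : {group gT}.

Lemma quotient_cyclic_factor A B N :
  A <| B -> B \subset 'N(N) -> cyclic (B / A) -> cyclic ((B / N) / (A / N)).
Proof.
move=> nsAB nNB /(cyclic_quotientP nsAB)[x Bx DB].
apply/(cyclic_quotientP (quotient_normal N nsAB)).
exists (coset N x); first exact: mem_quotient.
have nNx := subsetP nNB x Bx; have nNA := subset_trans (normal_sub nsAB) nNB.
by rewrite -quotient_cycle // -quotientY ?cycle_subG // -DB.
Qed.

Lemma supersoluble_quotient G N :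
  supersoluble G -> N <| G -> supersoluble (G / N)%G.
Proof.
case=> s [path_s last_s /allP nsG] /andP[_ nNG].
exists [seq (A / N)%G | A : {group gT} <- s]; split; last first.
- by apply/allP=> _ /mapP[A /nsG nAG ->]; apply: quotient_normal.
- have -> : 1%G = (1%G / N)%G :> {group coset_of N}.
    by apply: val_inj; rewrite /= quotient1.
  by rewrite -last_s -(last_map (fun A : {group gT} => (A / N)%G)).
have -> : 1%G = (1%G / N)%G :> {group coset_of N}.
  by apply: val_inj; rewrite /= quotient1.
have {nsG last_s}: all (fun A : {group gT} => A <| G) (1%G :: s).
  by rewrite /= normal1; apply/allP.
elim: s 1%G path_s => //= B s IHs A /andP[/andP[sAB cycBA] path_s].
case/and3P=> nAG nBG ns; rewrite IHs ?nBG // quotientS //= andbT.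
apply: quotient_cyclic_factor => //; first exact: normalS (normal_sub nBG) nAG.
exact: subset_trans (normal_sub nBG) nNG.
Qed.

(** The series consists of [N] followed by the preimages of the series of [G / N]; a generator of
    each later factor lifts along [coset N]. *)
Lemma supersoluble_ext G N :
  N <| G -> cyclic N -> supersoluble (G / N)%G -> supersoluble G.
Proof.
move=> nNG cycN [s [path_s last_s /allP nsG]].
pose f (A : {group coset_of N}) := (coset N @*^-1 A)%G.
have f1 : f 1%G = N by apply: val_inj; rewrite /= -[RHS](ker_coset N).
exists (N :: map f s); split=> /=.
- rewrite sub1G -(isog_cyclic (quotient1_isog N)) cycN /= -[in path _ N]f1.
  have: all (fun A : {group coset_of N} => A <| G / N) (1%G :: s).
    by rewrite /= normal1; apply/allP.
  elim: s 1%G {last_s nsG} path_s => //= B s IHs A.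
  case/andP=> /andP[sAB cycBA] path_s /and3P[nAG nBG ns].
  rewrite IHs ?nBG // andbT morphpreS //=.
  have nsAB := normalS sAB (normal_sub nBG) nAG.
  have /(cyclic_quotientP nsAB)[u Bu DB] := cycBA.
  have [x nNx Du] := cosetP u.
  have nsfAB: f A <| f B by rewrite cosetpre_normal.
  apply/(cyclic_quotientP nsfAB); exists x.
    by apply: mem_morphpre; rewrite //= -Du.
  have sNfA: N \subset f A := normal_sub (normal_cosetpre A).
  change (f B :=: (f A <*> <[x]>)%G).
  apply: (@quotient_inj _ N); first exact: normal_cosetpre.
    by rewrite /normal join_subG cycle_subG nNx !(subset_trans sNfA) ?joing_subl
         ?normal_norm ?normal_cosetpre.
  rewrite /= cosetpreK quotientY ?cycle_subG ?normal_norm ?normal_cosetpre //.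
  by rewrite cosetpreK quotient_cycle // -Du.
- by rewrite -[X in last X _]f1 last_map last_s; apply: val_inj; rewrite /= quotientGK.
- rewrite nNG; apply/allP=> _ /mapP[A /nsG nAG ->].
  by rewrite -(quotientGK nNG) cosetpre_normal.
Qed.

(** Subgroups of a cyclic group are characteristic, so [G] normalises a subgroup of prime order of
    [N], and minimality makes it all of [N]. *)
Lemma minnormal_cyclic_prime G N : minnormal N G -> cyclic N -> prime #|N|.
Proof.
case/mingroupP=> /andP[ntN nNG] minN cycN.
have /cyclicP[x Dx] := cycN.
have [p p_pr pN] : exists2 p, prime p & p %| #|N|.
  by exists (pdiv #|N|); rewrite ?pdiv_prime ?pdiv_dvd ?cardG_gt1.
have [y Ny oy] := Cauchy p_pr pN.
suff <- : <[y]> = N by rewrite -orderE oy.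
apply: minN; last by rewrite cycle_subG.
rewrite -cardG_gt1 -orderE oy prime_gt1 //=.
by apply: char_norm_trans nNG; rewrite sub_cyclic_char // cycle_subG.
Qed.

(** Let [B] be the first term of the series meeting [N] nontrivially and [A] the term before it.
    Then [N] lies in [B] and meets [A] trivially, so it embeds in the cyclic group [B / A]. *)
Lemma supersoluble_minnormal_prime G N :
  supersoluble G -> minnormal N G -> N \subset G -> prime #|N|.
Proof.
move=> [s [path_s last_s /allP nsG]] minN sNG.
apply: (minnormal_cyclic_prime minN); have /mingroupP[/andP[ntN nNG] minN'] := minN.
have: all (fun A : {group gT} => A <| G) (1%G :: s).
  by rewrite /= normal1; apply/allP.
have tiN1: N :&: 1%G = 1 by apply/setIidPr; apply: sub1G.
elim: s 1%G path_s last_s tiN1 {nsG} => /= [A _ -> tiNG|B s IHs A].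
  by rewrite -tiNG (setIidPl sNG) eqxx in ntN.
case/andP=> /andP[sAB cycBA] path_s last_s tiNA /and3P[nAG nBG ns].
have [tiNB | ntNB] := eqVneq (N :&: B) 1; first by apply: (IHs B); rewrite ?nBG.
have sNB: N \subset B.
  apply/setIidPl; apply: minN'; rewrite ?subsetIl // ntNB normsI //.
  exact: normal_norm.
have nAN: N \subset 'N(A) := subset_trans sNG (normal_norm nAG).
rewrite setIC in tiNA; rewrite (isog_cyclic (quotient_isog nAN tiNA)).
exact: cyclicS (quotientS _ sNB) cycBA.
Qed.

(** The intersection [N :&: X] is normalised by [X] and by the abelian group [N], hence by
    [N * X = G], so minimality of [N] makes it trivial. *)
Lemma minnormal_abelian_maximal G N X :
  minnormal N G -> N \subset G -> abelian N -> maximal X G -> ~~ (N \subset X) ->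
  [/\ N * X = G, N :&: X = 1 & #|G : X| = #|N|].
Proof.
case/mingroupP=> /andP[ntN nNG] minN sNG abN /maxgroupP[/andP[sXG nsGX] maxX] nsNX.
have defG: N * X = G.
  rewrite -norm_joinEr ?(subset_trans sXG) //; apply/eqP; rewrite eqEproper.
  rewrite join_subG sNG sXG /=; apply: contra nsNX => prX.
  by rewrite -(maxX (N <*> X)%G) ?joing_subl ?joing_subr.
have tiNX: N :&: X = 1.
  apply/eqP; apply: contraR nsNX => ntNX; apply/setIidPl; apply: minN; rewrite ?subsetIl //.
  rewrite ntNX -{1}defG mulG_subG [X \subset _]normsI ?normG ?(subset_trans sXG nNG) //.
  by rewrite sub_abelian_norm ?subsetIl.
split=> //; apply/eqP; rewrite -(eqn_pmul2l (cardG_gt0 X)) Lagrange // mulnC.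
by rewrite -TI_cardMg ?defG.
Qed.

Lemma maximal_normal_index_prime G X :
  solvable G -> maximal X G -> X <| G -> prime #|G : X|.
Proof.
move=> solG maxX nXG; rewrite -card_quotient ?normal_norm //.
apply: simple_sol_prime; first exact: quotient_sol.
rewrite quotient_simple //; apply/maxgroupP; have /maxgroupP[prX mX] := maxX.
by split=> [|H /andP[prH _]]; [rewrite prX normal_norm | apply: mX].
Qed.

End Quotients.

(** Induction on the order: a minimal normal [N] has prime order; either it lies in [X] and can be
    factored out, or [X] complements it and has index [#|N|]. *)
Lemma supersoluble_maximal_index_prime (gT : finGroupType) (G X : {group gT}) :
  supersoluble G -> maximal X G -> prime #|G : X|.
Proof.
have [n] := ubnP #|G|; elim: n => // n IHn in gT G X * => /ltnSE-Gn ssG maxX.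
have /maxgroupP[/andP[sXG nsGX] _] := maxX.
have ntG : G :!=: 1 by apply: contraNneq nsGX => ->; apply: sub1G.
have [N minN sNG] := minnormal_exists ntG (normG G).
have prN := supersoluble_minnormal_prime ssG minN sNG.
have /mingroupP[/andP[ntN nNG] _] := minN.
have [sNX | nsNX] := boolP (N \subset X); last first.
  have abN : abelian N by rewrite cyclic_abelian ?prime_cyclic.
  by have [_ _ ->] := minnormal_abelian_maximal minN sNG abN maxX nsNX.
have nsNG : N <| G by rewrite /normal sNG.
rewrite -(index_quotient_eq _ sXG nNG) ?subIset ?sNX ?orbT //.
apply: (IHn _ (G / N)%G (X / N)%G _ (supersoluble_quotient ssG nsNG)).
  by apply: leq_trans Gn; rewrite ltn_quotient.
by rewrite quotient_maximal // (normalS sNX sXG).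
Qed.

(** * Fitting and Frattini subgroups *)

(** Otherwise [C / Z] contains a minimal normal subgroup [M / Z] of [G / Z], which is abelian. Since
    [Z] is central in [M], the normal subgroup [M] is nilpotent, hence lies in ['F(G) :&: C = Z], a
    contradiction. *)
Lemma cent_sub_Fitting (gT : finGroupType) (G : {group gT}) :
  solvable G -> 'C_G('F(G)) \subset 'F(G).
Proof.
move=> solG; set C := 'C_G('F(G))%G; set Z := ('F(G) :&: C)%G.
have nsFG : 'F(G) <| G := Fitting_normal G.
have nsCG : C <| G by rewrite /normal subsetIl normsI ?normG ?norms_cent ?normal_norm.
have nsZG : Z <| G by apply: normalI.
apply: contraT => nsCF; have nCZ: G \subset 'N(Z) := normal_norm nsZG.
have ntCZ: C / Z != 1.
  apply: contra nsCF; rewrite -subG1 quotient_sub1; last first.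
    exact: subset_trans (normal_sub nsCG) nCZ.
  by rewrite subsetI => /andP[].
have [Mb minMb sMbC] := minnormal_exists ntCZ (quotient_norms Z (normal_norm nsCG)).
have sMbG := subset_trans sMbC (quotientS Z (normal_sub nsCG)).
have [nMbG ntMb /is_abelemP[p _ /abelem_abelian abMb]] :=
  minnormal_solvable minMb sMbG (quotient_sol Z solG).
have nsMbG : Mb <| G / Z by rewrite /normal sMbG.
have [M defMb sZM nsMG] := inv_quotientN nsZG nsMbG.
have sMC : M \subset C.
  have sZC : Z \subset C by apply: subsetIr.
  rewrite -(quotientSGK _ sZC) -?defMb //.
  exact: subset_trans (normal_sub nsMG) nCZ.
have nilM : nilpotent M.
  have sZZM : Z \subset 'Z(M).
    rewrite subsetI sZM (subset_trans (subsetIl _ _)) // centsC.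
    exact: subset_trans sMC (subsetIr _ _).
  rewrite -quotient_center_nil abelian_nil //.
  rewrite sub_der1_abelian //; apply: subset_trans sZZM; apply: der1_min.
    exact: subset_trans (normal_sub nsMG) nCZ.
  by rewrite -defMb.
case/eqP: ntMb; rewrite defMb; apply/trivgP; rewrite quotient_sub1.
  by rewrite subsetI (Fitting_max nsMG nilM).
exact: subset_trans (normal_sub nsMG) nCZ.
Qed.

Section Frattini.
Variable gT : finGroupType.
Implicit Types E G H K N P M A B X R W Y : {group gT}.

Lemma mul_Frattini_sub G N X :
  N \subset 'Phi(G) -> X \subset G -> N * X = G -> X :=: G.
Proof.
move=> sNP sXG defG; case: (maximal_exists sXG) => // -[M maxM sXM].
have /maxgroupP[/andP[_ /negP nsGM] _] := maxM; case: nsGM.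
by rewrite -{1}defG mul_subG // (subset_trans sNP (Phi_sub_max maxM)).
Qed.

(* The Frattini argument makes the Sylow subgroups of K normal in G. *)
Lemma nilpotent_mod_Frattini G K N :
    K <| G -> N <| G -> N \subset 'Phi(G) -> N \subset K -> nilpotent (K / N) ->
  nilpotent K.
Proof.
move=> nsKG nsNG sNPhi sNK nilKN.
have nNK := subset_trans (normal_sub nsKG) (normal_norm nsNG).
have nsNK : N <| K by rewrite /normal sNK.
suff <- : 'F(K) = K by apply: Fitting_nil.
apply/eqP; rewrite eqEsubset Fitting_sub /= -{1}(Sylow_gen K) gen_subG.
apply/bigcupsP=> P /SylowP[p p_pr sylP].
have sPK := pHall_sub sylP; have nNP := subset_trans sPK nNK.
have nsNPG : N <*> P <| G.
  have nsNNP : N <| N <*> P by rewrite /normal joing_subl join_subG normG.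
  suff: coset N @*^-1 ((N <*> P) / N) <| coset N @*^-1 (G / N).
    by rewrite !quotientGK.
  rewrite cosetpre_normal quotientYidl //.
  have sylPN := quotient_pHall nNP sylP.
  rewrite (nilpotent_Hall_pcore nilKN sylPN).
  by apply: char_normal_trans (pcore_char _ _) _; apply: quotient_normal.
have sylPNP : p.-Sylow(N <*> P) P.
  by apply: pHall_subl sylP; rewrite ?joing_subr // join_subG sNK.
have defG : N * 'N_G(P) = G.
  rewrite -[RHS](Frattini_arg nsNPG sylPNP) /= norm_joinEr // -mulgA.
  congr (_ * _); apply/esym/mulSGid.
  by rewrite subsetI normG (subset_trans sPK (normal_sub nsKG)).
have nPG : 'N_G(P) = G := mul_Frattini_sub sNPhi (subsetIl _ _) defG.
rewrite Fitting_max ?(pgroup_nil (pHall_pgroup sylP)) //.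
by rewrite /normal sPK -(setIidPl (normal_sub nsKG)) -nPG setICA subIset ?subsetIr ?orbT.
Qed.

(* H is a Hall p'-subgroup of K, normal by the Frattini argument. *)
Lemma normal_complement_mod_Frattini p G K N :
    solvable G -> p.-group N -> N <| G -> N \subset 'Phi(G) -> N \subset K -> K <| G ->
  p^'.-group (K / N) -> exists H : {group gT}, [/\ H <| G, p^'.-group H & N * H = K].
Proof.
move=> solG pN nsNG sNPhi sNK nsKG p'KN.
have nNK := subset_trans (normal_sub nsKG) (normal_norm nsNG).
have solK := solvableS (normal_sub nsKG) solG.
have [H hallH] := Hall_exists p^' solK.
have [sHK p'H _] := and3P hallH.
have defK : N * H = K.
  apply/eqP; rewrite eqEcard mul_subG //= coprime_cardMg ?(pnat_coprime pN) //.
  rewrite (card_Hall hallH) -(Lagrange sNK) -card_quotient // partnM ?cardG_gt0 //.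
  by rewrite (part_pnat_id p'KN) (part_p'nat (_ : p^'^'.-nat _)) ?mul1n ?pnatNK.
exists H; split=> //.
have defG : N * 'N_G(H) = G.
  rewrite -[RHS](Hall_Frattini_arg solK nsKG hallH) -defK -mulgA.
  congr (_ * _); apply/esym/mulSGid.
  by rewrite subsetI normG (subset_trans sHK (normal_sub nsKG)).
have nHG := mul_Frattini_sub sNPhi (subsetIl _ _) defG.
by rewrite /normal (subset_trans sHK (normal_sub nsKG)) -{1}nHG subsetIr.
Qed.

(** Put [N = 'F(E) :&: 'Phi(G)]. The preimage [K] of ['F(E / N)] is nilpotent, hence inside ['F(E)],
    so [W / N] centralises ['F(E / N)]. In a soluble group the Fitting subgroup contains its
    centraliser, so [W] lies in [K]. *)
Lemma sub_Fitting_mod_Frattini G E W :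
    solvable G -> E <| G -> W <| G -> W \subset E ->
  [~: 'F(E), W] \subset 'Phi(G) -> W \subset 'F(E).
Proof.
move=> solG nsEG nsWG sWE sFWPhi.
have nsFG : 'F(E) <| G := char_normal_trans (Fitting_char E) nsEG.
pose N := ('F(E) :&: 'Phi(G))%G.
have nsNG : N <| G by rewrite normalI ?Phi_normal.
have nNE := subset_trans (normal_sub nsEG) (normal_norm nsNG).
have sNE : N \subset E by rewrite subIset ?Fitting_sub.
have nsNE : N <| E by rewrite /normal sNE.
have nsKb : 'F(E / N) <| G / N.
  exact: char_normal_trans (Fitting_char _) (quotient_normal _ nsEG).
have [K defK sNK nsKG] := inv_quotientN nsNG nsKb.
have sKE : K \subset E.
  rewrite -(quotientSGK _ sNE) -?defK ?Fitting_sub //.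
  by rewrite (subset_trans (normal_sub nsKG)) ?normal_norm.
have nilK : nilpotent K.
  apply: (nilpotent_mod_Frattini nsKG nsNG); rewrite ?subsetIr // -defK.
  exact: Fitting_nil.
have sKF : K \subset 'F(E) by rewrite Fitting_max // (normalS sKE (normal_sub nsEG)).
apply: (subset_trans _ sKF); rewrite -(quotientSGK _ sNK) ?(subset_trans sWE) // -defK.
apply: subset_trans (cent_sub_Fitting (quotient_sol N (solvableS (normal_sub nsEG) solG))).
rewrite subsetI quotientS //= centsC defK; apply: subset_trans (quotientS N sKF) _.
rewrite quotient_cents2r // subsetI sFWPhi andbT commg_subl.
exact: subset_trans sWE (gFnorm _ _).
Qed.

End Frattini.

(** * Eigenvectors of elements acting with exponent dividing p - 1 *)

Section Eigenvector.
Import GRing.Theory.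

(* The linear map induced by x is a root of X^p - X, which splits over F_p. *)
Lemma abelem_eigenvector (gT : finGroupType) (p : nat) (N : {group gT}) x :
    prime p -> p.-abelem N -> N :!=: 1 -> x \in 'N(N) -> x ^+ p.-1 \in 'C(N) ->
  exists2 v, v \in N^# & exists a, v ^ x = v ^+ a.
Proof.
move=> p_pr abelN ntN nNx cNxp.
have nNX : <[x]> \subset 'N(N) by rewrite cycle_subG.
pose rG := abelem_repr abelN ntN nNX.
have Xx := cycle_id x.
have rXp : (rG x ^+ p.-1 = 1)%R.
  have /rkerP[_ rGxp] : x ^+ p.-1 \in rker rG by rewrite rker_abelem inE mem_cycle.
  by rewrite -repr_mxX // rGxp.
have [a /eigenvalueP[v Dv nz_v]] : exists a, eigenvalue (rG x) a.
  apply/existsP; apply: contraT; rewrite negb_exists => /forallP noev.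
  have: (horner_mx (rG x) ('X^#|'F_p| - 'X) \is a GRing.unit)%R.
    rewrite finField_genPoly rmorph_prod /=; apply: GRing.unitr_prod => b _.
    rewrite rmorphB /= horner_mx_X horner_mx_C.
    have := noev b; rewrite /eigenvalue /eigenspace kermx_eq0 negbK row_free_unit.
    by [].
  rewrite card_Fp // rmorphB /= rmorphXn /= !horner_mx_X.
  have -> : (rG x ^+ p = rG x)%R.
    by rewrite -[RHS]mulr1 -rXp -exprS prednK ?prime_gt0.
  by rewrite subrr unitr0.
exists (rVabelem abelN ntN v).
  by rewrite !inE mem_rVabelem andbT -(rVabelem0 abelN ntN) (inj_eq (@rVabelem_inj _ _ _ _ _)).
by exists a; rewrite -(rVabelemJ abelN ntN nNX) // Dv rVabelemZ.
Qed.

End Eigenvector.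

(** * The residual for abelian groups of exponent dividing p - 1 *)

Section Residual.
Variable p : nat.

(* The least normal subgroup with abelian quotient of exponent dividing p - 1. *)
Definition pm1_residual (gT : finGroupType) (G : {set gT}) : {set gT} :=
  <<[set x ^+ p.-1 | x in G] :|: G^`(1)>>.

Canonical pm1_residual_group (gT : finGroupType) (G : {set gT}) :=
  Eval hnf in [group of pm1_residual G].

Lemma pm1_residual_sub (gT : finGroupType) (G : {group gT}) : pm1_residual G \subset G.
Proof.
rewrite gen_subG subUset der_sub andbT.
by apply/subsetP=> _ /imsetP[x Gx ->]; apply: groupX.
Qed.

Lemma pm1_residual_normal (gT : finGroupType) (G : {group gT}) : pm1_residual G <| G.
Proof. by rewrite sub_der1_normal ?pm1_residual_sub // sub_gen // subsetUr. Qed.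

Lemma pm1_residual_quotient (gT : finGroupType) (G N : {group gT}) :
  N <| G -> pm1_residual G / N \subset pm1_residual (G / N).
Proof.
case/andP=> _ nNG; have nNX: [set x ^+ p.-1 | x in G] \subset 'N(N).
  by apply: subset_trans nNG; apply/subsetP=> _ /imsetP[x Gx ->]; apply: groupX.
rewrite /pm1_residual quotient_gen ?subUset ?nNX ?(subset_trans (der_sub 1 G)) //.
rewrite genS // quotientU quotient_der // setSU //.
apply/subsetP=> _ /morphimP[_ _ /imsetP[x Gx ->] ->].
by apply/imsetP; exists (coset N x); rewrite ?mem_quotient ?morphX ?(subsetP nNG).
Qed.

(** [Aut N] is abelian of order [p.-1], so the conjugation action kills commutators and [p.-1]-th
    powers. *)
Lemma pm1_residual_cent_order_p (gT : finGroupType) (G N : {group gT}) :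
  prime p -> N <| G -> #|N| = p -> pm1_residual G \subset 'C(N).
Proof.
move=> p_pr /andP[_ nNG] oN; have prN : prime #|N| by rewrite oN.
pose f := [morphism of conj_aut N].
have fG x : x \in G -> f x \in Aut N by move=> Gx; apply: Aut_aut.
rewrite -ker_conj_aut !gen_subG subUset; apply/andP; split.
  apply/subsetP=> _ /imsetP[x Gx ->].
  have nNx := subsetP nNG x Gx.
  apply/kerP; rewrite ?groupX // morphX //=.
  have oA : #|Aut N| = p.-1 by rewrite card_Aut_cyclic ?prime_cyclic // oN totient_prime.
  by rewrite -oA expg_cardG ?fG.
rewrite gen_subG; apply/subsetP=> _ /imset2P[x y Gx Gy ->].
have nNx := subsetP nNG x Gx; have nNy := subsetP nNG y Gy.
apply/kerP; rewrite ?groupR // morphR //=; apply/eqP/commgP.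
have abA := Aut_cyclic_abelian (prime_cyclic prN).
by apply: (centsP abA); rewrite fG.
Qed.

(** A minimal normal subgroup [N] of [G] inside [R] has order [p], so [Y] centralises it. By
    induction [Y] centralises [R / N], and coprime action then lifts this to [R]. *)
Lemma supersoluble_pm1_residual_cent (gT : finGroupType) (G R Y : {group gT}) :
    prime p -> supersoluble G -> R <| G -> p.-group R -> p^'.-group Y ->
  Y \subset pm1_residual G -> Y \subset 'C(R).
Proof.
have [n] := ubnP #|G|; elim: n => // n IHn in gT G R Y * => /ltnSE-Gn p_pr ssG nsRG pR p'Y sYK.
have [-> | ntR] := eqVneq R 1%G; first by rewrite cents1.
have [N minN sNR] := minnormal_exists (ntR : R :!=: 1) (normal_norm nsRG).
have sNG := subset_trans sNR (normal_sub nsRG).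
have prN := supersoluble_minnormal_prime ssG minN sNG.
have /mingroupP[/andP[ntN nNG] _] := minN.
have nsNG : N <| G by rewrite /normal sNG.
have oN : #|N| = p.
  by have := pgroupS sNR pR; rewrite /pgroup pnatE // => /eqP.
have sYG := subset_trans sYK (pm1_residual_sub G).
have cNY : Y \subset 'C(N) := subset_trans sYK (pm1_residual_cent_order_p p_pr nsNG oN).
have cRYb : Y / N \subset 'C(R / N).
  apply: (IHn _ (G / N)%G); rewrite ?quotient_normal ?quotient_pgroup //.
  - by apply: leq_trans Gn; rewrite ltn_quotient.
  - exact: supersoluble_quotient.
  - exact: subset_trans (quotientS N sYK) (pm1_residual_quotient nsNG).
have := coprime_quotient_cent sNR (subset_trans sYG nNG) (pnat_coprime pR p'Y) (pgroup_sol pR).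
have -> : 'C_(R / N)(Y / N) = R / N by apply/setIidPl; rewrite centsC.
move=> eqR.
have sNC : N \subset 'C_R(Y) by rewrite subsetI sNR centsC.
suff <- : 'C_R(Y) = R by rewrite centsC subsetIr.
apply: (quotient_inj _ _ eqR); rewrite /normal ?sNC ?sNR (subset_trans _ nNG) //.
  by rewrite subIset ?(normal_sub nsRG).
exact: normal_sub.
Qed.

End Residual.

(** The Fitting subgroup of [A / B] is a [p]-group, so a Hall [p^']-subgroup [Y] of [A / B]
    centralises it. Hence [Y] lies in it and is trivial. *)
Lemma supersoluble_pm1_residual_pquotient (gT : finGroupType) p (G : {group gT}) :
    prime p -> solvable G -> supersoluble G ->
  p.-group (pm1_residual p G / 'O_p^'(pm1_residual p G)).
Proof.
move=> p_pr solG ssG; set A := [group of pm1_residual p G]; set B := 'O_p^'(A).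
have nsAG : A <| G := pm1_residual_normal p G.
have nsBG : B <| G := char_normal_trans (pcore_char _ _) nsAG.
have solA : solvable (A / B) := quotient_sol B (solvableS (normal_sub nsAG) solG).
have [Y hallY] := Hall_exists p^' solA.
have [sYA p'Y _] := and3P hallY.
have defF : 'F(A / B) = 'O_p(A / B) := Fitting_eq_pcore (trivg_pcore_quotient _ _).
have nsFG : 'F(A / B) <| G / B.
  exact: char_normal_trans (Fitting_char _) (quotient_normal _ nsAG).
have pF : p.-group 'F(A / B) by rewrite defF pcore_pgroup.
have cFY : Y \subset 'C('F(A / B)).
  apply: (supersoluble_pm1_residual_cent p_pr (supersoluble_quotient ssG nsBG) nsFG pF p'Y).
  exact: subset_trans sYA (pm1_residual_quotient p nsBG).
have sYF : Y \subset 'F(A / B).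
  by apply: subset_trans (cent_sub_Fitting solA); rewrite subsetI sYA.
have Y1 : Y :==: 1.
  by rewrite trivg_card1 (pnat_1 (pgroupS sYF pF) p'Y).
rewrite -pgroupNK -partG_eq1 -(card_Hall hallY) -trivg_card1.
exact: Y1.
Qed.

(** * Saturation: minimal normal subgroups inside the Frattini subgroup *)

Section Saturation.
Variable gT : finGroupType.
Implicit Types G N : {group gT}.

(* Let A / N be the residual of G / N.  Then A = H * S with H a normal p'-subgroup
   of G, which centralizes N, and S a p-group containing N, so that N :&: 'Z(S) is a
   nontrivial subgroup of 'C_N(A). *)
Lemma Frattini_minnormal_pm1_residual_cent p G N :
    prime p -> solvable G -> supersoluble (G / N)%G -> minnormal N G ->
    p.-abelem N -> N \subset 'Phi(G) ->
  pm1_residual p G \subset 'C(N).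
Proof.
move=> p_pr solG ssGN minN abelN sNPhi.
have /mingroupP[/andP[ntN nNG] minN'] := minN.
have sNG := subset_trans sNPhi (Phi_sub G).
have nsNG : N <| G by rewrite /normal sNG.
have pN := abelem_pgroup abelN.
have nsAb : pm1_residual p (G / N) <| G / N := pm1_residual_normal p (G / N).
have [A defA sNA nsAG] := inv_quotientN nsNG nsAb.
have nsBb : 'O_p^'(A / N) <| G / N.
  exact: char_normal_trans (pcore_char _ _) (quotient_normal N nsAG).
have [B defB sNB nsBG] := inv_quotientN nsNG nsBb.
have [sAG nAG] := andP nsAG.
have sBA : B \subset A.
  rewrite -(quotientSGK _ sNA) -?defB ?pcore_sub //.
  exact: subset_trans (normal_sub nsBG) nNG.
have p'BN : p^'.-group (B / N) by rewrite -defB pcore_pgroup.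
have [H [nsHG p'H defNH]] :=
  normal_complement_mod_Frattini solG pN nsNG sNPhi sNB nsBG p'BN.
have [sHG nHG] := andP nsHG.
have cNH : H \subset 'C(N).
  apply/commG1P/trivgP; have <- := coprime_TIg (pnat_coprime pN p'H).
  by rewrite subsetI commg_subl commg_subr (subset_trans sHG) ?(subset_trans sNG).
have pAB : p.-group (A / B).
  have := supersoluble_pm1_residual_pquotient p_pr (quotient_sol N solG) ssGN.
  have eB : 'O_p^'(A / N) = B / N := defB.
  rewrite defA eB /pgroup.
  by rewrite -(card_isog (third_isog sNB (normalS sNA sAG nsNG) (normalS sBA sAG nsBG))).
have [S sylS] := Sylow_exists p A.
have [sSA pS _] := and3P sylS.
have nBA := subset_trans sAG (normal_norm nsBG).
have sNS : N \subset S.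
  apply: subset_trans (pcore_sub_Hall sylS).
  by rewrite pcore_max // (normalS sNA sAG).
have defA' : A :=: H * S.
  have sSB : S / B = A / B.
    have sylSB := quotient_pHall (subset_trans sSA nBA) sylS.
    by rewrite (pHall_id sylSB).
  have sAB : B * S = A.
    by rewrite -(quotientK (subset_trans sSA nBA)) sSB quotientGK // (normalS sBA sAG).
  by rewrite -sAB -defNH -(normC (cents_norm cNH)) -mulgA (mulSGid sNS).
have ntNA : 'C_N(A) != 1.
  have nsNS : N <| S by rewrite (normalS sNS (subset_trans sSA sAG)).
  apply: contra (meet_center_nil (pgroup_nil pS) nsNS ntN) => /eqP CN1.
  rewrite -subG1 -CN1 subsetI subsetIl centsC defA' mulG_subG.
  rewrite (subset_trans cNH) ?centS ?subsetIl //.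
  by rewrite centsC (subset_trans (subsetIr _ _)) ?subsetIr.
have cNA : A \subset 'C(N).
  rewrite centsC; apply/setIidPl; apply: minN'; rewrite ?subsetIl // ntNA.
  by rewrite normsI // norms_cent.
apply: subset_trans cNA; rewrite -(quotientSGK _ sNA) ?(subset_trans (pm1_residual_sub p G)) //.
by rewrite -defA; apply: pm1_residual_quotient.
Qed.

(** Each element of [G] acts on [N] as a power map, so [G] normalises the cyclic subgroups of [N]
    and minimality makes [N] cyclic. An eigenvector exists because [x ^+ p.-1] centralises [N]; its
    eigenspace is all of [N] because [G] acts as an abelian group. *)
Lemma minnormal_pm1_residual_cent_prime p G N :
    prime p -> N <| G -> minnormal N G -> p.-abelem N -> pm1_residual p G \subset 'C(N) ->
  prime #|N|.
Proof.
move=> p_pr /andP[sNG nNG] minN abelN cNK.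
have /mingroupP[/andP[ntN _] minN'] := minN.
apply: (minnormal_cyclic_prime minN).
have abN := abelem_abelian abelN.
have pow x : x \in G -> exists a, {in N, forall v, v ^ x = v ^+ a}.
  move=> Gx; have nNx := subsetP nNG x Gx.
  have cNxp : x ^+ p.-1 \in 'C(N).
    apply: (subsetP cNK); apply/mem_gen/setUP; left.
    by apply/imsetP; exists x.
  have [v /setD1P[ntv Nv] [a va]] := abelem_eigenvector p_pr abelN ntN nNx cNxp.
  exists a.
  pose E := [set w in N | w ^ x == w ^+ a].
  have gE : group_set E.
    apply/group_setP; split; first by rewrite inE group1 conj1g expg1n /=.
    move=> u w /setIdP[Nu /eqP ux] /setIdP[Nw /eqP wx]; rewrite inE groupM //=.
    by rewrite conjMg ux wx expgMn //; apply: (centsP abN).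
  have nEG : G \subset 'N(group gE).
    apply/subsetP=> y Gy; rewrite inE; apply/subsetP=> _ /imsetP[w /setIdP[Nw /eqP wx] ->].
    rewrite inE memJ_norm ?(subsetP nNG) // Nw /=.
    (* The actions of [x] and [y] on [N] commute, so [y] maps the eigenspace of [x] to itself. *)
    have cxy : [~ x, y] \in 'C(N).
      apply: (subsetP cNK); apply/mem_gen/setUP; right.
      exact: mem_commg.
    rewrite -conjXg -wx -!conjgM [x * y]commgC (conjgM w (y * x)).
    have Nwyx : w ^ (y * x) \in N by rewrite memJ_norm ?groupM // (subsetP nNG) ?groupM.
    by rewrite [X in _ == X]conjgE -(centP cxy _ Nwyx) mulKg.
  have defE : group gE :=: N.
    apply: minN'; last by apply/subsetP=> w /setIdP[].
    rewrite nEG andbT; apply/trivgPn; exists v => //.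
    by rewrite inE Nv va eqxx.
  move=> w Nw; have Ew : w \in group gE by rewrite defE.
  by case/setIdP: Ew => _ /eqP.
have [v Nv ntv] := trivgPn _ ntN.
suff <- : <[v]> = N by apply: cycle_cyclic.
apply: minN'; last by rewrite cycle_subG.
rewrite /= cycle_eq1 ntv /=; apply/subsetP=> x Gx; have [a xa] := pow x Gx.
by rewrite inE -cycleJ cycle_subG xa ?mem_cycle.
Qed.

End Saturation.

(** * Huppert's theorem *)

(** Induction on the order makes [G / N] supersoluble for a minimal normal [N], so only [#|N|] must
    be shown prime. If [N] lies in ['Phi(G)], saturation gives this; otherwise a maximal subgroup
    complements [N] and its index is [#|N|]. *)
Lemma maximal_index_prime_supersoluble (gT : finGroupType) (G : {group gT}) :
    solvable G -> (forall X : {group gT}, maximal X G -> prime #|G : X|) ->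
  supersoluble G.
Proof.
have [n] := ubnP #|G|; elim: n => // n IHn in gT G * => /ltnSE-Gn solG prX.
have [G1 | ntG] := eqVneq G 1%G.
  by exists [::]; split; rewrite ?G1.
have [N minN sNG] := minnormal_exists (ntG : G :!=: 1) (normG G).
have [nNG ntN /is_abelemP[p p_pr abelN]] := minnormal_solvable minN sNG solG.
have nsNG : N <| G by rewrite /normal sNG.
have ssGN : supersoluble (G / N)%G.
  apply: IHn; rewrite ?quotient_sol //.
    by apply: leq_trans Gn; rewrite ltn_quotient.
  move=> Xb maxXb; have [sXbG _] := andP (maxgroupp maxXb).
  have [X defX sNX sXG] := inv_quotientS nsNG sXbG.
  rewrite defX index_quotient_eq ?prX ?subIset ?sNX ?orbT //.
  by rewrite -(quotient_maximal (normalS sNX sXG nsNG) nsNG) -defX.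
suff prN: prime #|N| by apply: supersoluble_ext nsNG (prime_cyclic prN) ssGN.
have [sNPhi | nsNPhi] := boolP (N \subset 'Phi(G)).
  apply: (minnormal_pm1_residual_cent_prime p_pr nsNG minN abelN).
  exact: Frattini_minnormal_pm1_residual_cent.
have [X maxX nsNX] : exists2 X : {group gT}, maximal X G & ~~ (N \subset X).
  apply/exists_inP; apply: contraR nsNPhi => /exists_inPn sNX.
  apply/bigcapsP=> X /predU1P[-> // | maxX].
  by apply: contraR (sNX X maxX) => ->.
have [_ _ <-] := minnormal_abelian_maximal minN sNG (abelem_abelian abelN) maxX nsNX.
exact: prX.
Qed.

(** * Central chief factors and the subgroup [ZU] *)

(** Matches conjugation by [g] with an element of the complement in [chief_sdprod], so that
    invariance inside the semidirect product gives invariance under [T]. *)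
Lemma conj_aut_image_act (gT : finGroupType) (T H K : {group gT}) g :
    K <| T -> H <| T -> g \in T ->
  exists a, [/\ a \in conj_aut_image T H K, a \in Aut (H / K) &
                {in H / K, forall u, a u = u ^ coset K g}].
Proof.
move=> /andP[_ nKT] /andP[_ nHT] Tg; have nKg := subsetP nKT g Tg.
have nHKg : coset K g \in 'N(H / K).
  by apply: (subsetP (quotient_norms K nHT)); apply: mem_quotient.
pose b := actperm ('J / K)%act g.
have bE u : b u = u ^ coset K g by rewrite /b actpermE qactJ nKg.
(* [restr_perm] agrees with [b] on [H / K] only once [b] is known to stabilise that set. *)
have nSb : b \in 'N(H / K | 'P).
  by apply/astabsP=> u; rewrite /= apermE bE memJ_norm.
have aE : {in H / K, forall u, restr_perm (H / K) b u = u ^ coset K g}.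
  by move=> u Hu; rewrite restr_permE // bE.
exists (restr_perm (H / K) b); split=> //.
  by rewrite /conj_aut_image !mem_morphim //= dom_qactJ.
rewrite inE restr_perm_on; apply/morphicP=> u v Hu Hv.
by rewrite !aE ?groupM // conjMg.
Qed.

(** The copy of [H / K] in the supersoluble group [W] contains a minimal normal subgroup [U] of [W],
    of prime order. Its preimage is invariant under [T / K], hence equals [H / K]. *)
Lemma U_central_chief_prime (gT : finGroupType) (T H K : {group gT}) :
  Defs.chief_factor T H K -> U_central T H K -> prime #|H / K|.
Proof.
case/and4P=> nsKT nsHT sKH /mingroupP[/andP[ntHK nHKT] minHK].
rewrite /U_central; set W := chief_sdprod T H K => ssW.
pose V := (H / K)%G; pose f1 := sdpair1 [Aut V]%gact; pose f2 := sdpair2 [Aut V]%gact.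
have inj1 : 'injm f1 := injm_sdpair1 _.
have sV1W : f1 @* V \subset W by apply: joing_subl.
have nsV1 : f1 @* V <| [set: sdprod_by [Aut V]%gact].
  by case/sdprod_context: (sdprod_sdpair [Aut V]%gact).
have ntV1 : f1 @* V != 1 by rewrite morphim_injm_eq1.
have nV1W : W \subset 'N(f1 @* V) := subset_trans (subsetT W) (normal_norm nsV1).
have [U minU sUV1] := minnormal_exists ntV1 nV1W.
have prU := supersoluble_minnormal_prime ssW minU (subset_trans sUV1 sV1W).
have /mingroupP[/andP[ntU nUW] _] := minU.
pose U0 := (f1 @*^-1 U)%G.
have defU : f1 @* U0 = U.
  by rewrite /= morphpreK // (subset_trans sUV1) // morphimS.
have sU0V : U0 \subset V by apply: subsetIl.
suff defV : U0 :=: V.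
  by rewrite -[#|H / K|]/#|V| -defV -(card_injm inj1 sU0V) defU.
apply: minHK => //; rewrite -(morphim_injm_eq1 inj1) // defU ntU /=.
apply/subsetP=> _ /morphimP[g nKg Tg ->].
have [a [imTa Aa aE]] := conj_aut_image_act nsKT nsHT Tg.
rewrite inE; apply/subsetP=> _ /imsetP[u U0u ->].
have Vu := subsetP sU0V u U0u.
have Uu : f1 u \in U by rewrite -defU mem_morphim.
have Wa : f2 a \in W.
  by apply: (subsetP (joing_subr _ _)); apply: mem_morphim.
rewrite -aE //; apply/morphpreP; split.
  rewrite aE // memJ_norm // (subsetP (quotient_norms K (normal_norm nsHT))) //.
  exact: mem_quotient.
have e : f1 (a u) = f1 u ^ f2 a := sdpair_act [Aut V]%gact Vu Aa.
by rewrite [X in X \in _]e memJ_norm // (subsetP nUW).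
Qed.

Section ZU.
Variable gT : finGroupType.
Implicit Types A B G H K N Y : {group gT}.

(** With [H = A :&: (N <*> B)] and [K = A :&: B], Dedekind's law gives [H * B = N * B]. So [H / K]
    is a chief factor below [A] with the order of [N]. *)
Lemma minnormal_join_prime G A B N :
    A <| G -> B <| G -> N <| G -> minnormal N G -> N \subset A * B -> N :&: B = 1 ->
    (forall H K, Defs.chief_factor G H K -> H \subset A -> prime #|H / K|) ->
  prime #|N|.
Proof.
move=> nsAG nsBG nsNG minN sNAB tiNB prA.
have /mingroupP[/andP[ntN _] minN'] := minN.
have nBG := normal_norm nsBG; have nBN := subset_trans (normal_sub nsNG) nBG.
pose K := (A :&: B)%G; pose H := (A :&: (N <*> B))%G.
have nsKG : K <| G by apply: normalI.
have nsHG : H <| G by rewrite normalI ?normalY.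
have sKH : K \subset H by rewrite setIS ?joing_subr.
have eNB : N <*> B = N * B by rewrite norm_joinEl.
have eHB : H * B = N * B.
  have sNBAB : N <*> B \subset A * B.
    by rewrite eNB; apply: subset_trans (mulSg B sNAB) _; rewrite -mulgA mulGid.
  by rewrite /= setIC group_modr ?joing_subr // (setIidPl sNBAB).
have oHK : #|H / K| = #|N|.
  have nBH := subset_trans (normal_sub nsHG) nBG.
  have eK : K :=: B :&: H.
    by rewrite /= setICA [B :&: _](setIidPl _) ?joing_subr.
  have eHBN : H / B = N / B by rewrite -quotientMidr eHB quotientMidr.
  rewrite eK (card_isog (second_isog nBH)) [LHS](congr1 (fun X : {set _} => #|X|) eHBN).
  by rewrite -(card_isog (quotient_isog nBN _)) // setIC.
rewrite -oHK; apply: prA; last exact: subsetIl.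
rewrite /Defs.chief_factor nsKG nsHG sKH /=; apply/mingroupP; split.
  by rewrite -cardG_gt1 oHK cardG_gt1 ntN quotient_norms ?normal_norm.
move=> Yb /andP[ntYb nYb] sYbH.
have nsYb : Yb <| G / K.
  by rewrite /normal nYb (subset_trans sYbH) ?quotientS ?normal_sub.
have [Y defY sKY nsYG] := inv_quotientN nsKG nsYb.
have sYH : Y \subset H.
  by rewrite -(quotientSGK _ sKH) -?defY // (subset_trans (normal_sub nsYG)) ?normal_norm.
have eYB : Y <*> B = Y * B by rewrite norm_joinEl ?(subset_trans (normal_sub nsYG)).
(* Minimality of [H / K]: if [N] meets [Y <*> B] trivially, then [Y] lies in [B] and so in [K];
   otherwise [N] lies in [Y * B], which forces [Y = H]. *)
have [tiNYB | ntNYB] := eqVneq (N :&: (Y <*> B)) 1.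
  case/eqP: ntYb; rewrite defY; apply/trivgP; rewrite quotient_sub1; last first.
    exact: subset_trans (normal_sub nsYG) (normal_norm nsKG).
  have sYBNB : Y <*> B \subset N * B.
    by rewrite -eHB eYB mulSg.
  rewrite subsetI (subset_trans sYH) ?subsetIl //=.
  have: N * B :&: (Y <*> B) = B.
    by rewrite setIC -group_modr ?joing_subr // setIC tiNYB mul1g.
  by rewrite (setIidPr sYBNB) => <-; apply: joing_subl.
have sNYB : N \subset Y * B.
  rewrite -eYB; apply/setIidPl; apply: minN'; rewrite ?subsetIl //.
  by rewrite ntNYB normsI ?normal_norm // normalY.
rewrite defY; suff -> : Y :=: H by []; apply/eqP; rewrite eqEsubset sYH /=.
have sYA := subset_trans sYH (subsetIl _ _).
have eY : Y * K = Y by rewrite mulGSid.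
rewrite -eY /= setIC [A :&: B]setIC group_modl // subsetI subsetIr andbT.
apply: subset_trans (subsetIl _ _) _; rewrite eNB.
by apply: subset_trans (mulSg B sNYB) _; rewrite -mulgA mulGid.
Qed.

(** Induction on the list of normal subgroups generating [ZU G]. Either [N] lies in the join [J] of
    the tail, or it meets [J] trivially and lies in [M * J], where all chief factors below [M] have
    prime order. *)
Lemma minnormal_ZU_prime G N :
  N <| G -> minnormal N G -> N \subset ZU G -> prime #|N|.
Proof.
move=> nsNG minN; rewrite /ZU -big_filter.
set s := filter _ _; have: all (fun M : {group gT} => (M <| G) &&
  pbool (forall H K, Defs.chief_factor G H K -> H \subset M -> U_central G H K)) s.
  exact: filter_all.
have /mingroupP[/andP[ntN nNG] minN'] := minN.
elim: s => [|M s IHs] /=.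
  by rewrite big_nil gen0 subG1 (negPf ntN).
case/andP=> /andP[nsMG]; rewrite /pbool.
case: ClassicalEpsilon.excluded_middle_informative => // cM _ sP.
rewrite big_cons; pose J := <<\bigcup_(L <- s) L>>%G => sNMJ.
have nsJG : J <| G.
  have /andP[sJG nJG]: (\bigcup_(L <- s) L \subset G) && (G \subset 'N(\bigcup_(L <- s) L)).
    rewrite big_seq; apply: (big_ind (fun X : {set gT} => (X \subset G) && (G \subset 'N(X)))).
    - by rewrite sub0set; apply/normsP=> x _; apply: imset0.
    - by move=> X Y /andP[sXG nXG] /andP[sYG nYG]; rewrite subUset sXG sYG normsU.
    - by move=> L /(allP sP)/andP[].
  by rewrite /normal gen_subG sJG norms_gen.
have [tiNJ | ntNJ] := eqVneq (N :&: J) 1; last first.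
  apply: IHs => //; apply/setIidPl; apply: minN'; rewrite ?subsetIl //.
  by rewrite ntNJ normsI // normal_norm.
apply: (minnormal_join_prime nsMG nsJG nsNG minN) => //.
  rewrite -norm_joinEl; last exact: subset_trans (normal_sub nsMG) (normal_norm nsJG).
  apply: subset_trans sNMJ _; rewrite gen_subG subUset joing_subl.
  exact: subset_trans (subset_gen _) (joing_subr _ _).
move=> H K chHK sHM; exact: (U_central_chief_prime chHK (cM _ _ chHK sHM)).
Qed.
End ZU.

Lemma norm_ZU (gT : finGroupType) (G : {group gT}) : G \subset 'N(ZU G).
Proof.
apply: norms_gen; apply: norms_bigcup; apply/bigcapsP=> N /andP[/andP[_ nNG] _].
exact: nNG.
Qed.

(** If [C <= Y <= C * N], then [Y = C * (N :&: Y)] by Dedekind's law, so a normal [Y] larger than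
    [C] meets [N] nontrivially and contains it. *)
Lemma minnormal_quotient (gT : finGroupType) (G N C : {group gT}) :
    minnormal N G -> N <| G -> C <| G -> N :&: C = 1 -> minnormal (N / C) (G / C).
Proof.
move=> minN nsNG nsCG tiNC; have /mingroupP[/andP[ntN _] minN'] := minN.
have nCN := subset_trans (normal_sub nsNG) (normal_norm nsCG).
apply/mingroupP; split.
  rewrite quotient_norms ?normal_norm // andbT -subG1 quotient_sub1 //.
  apply: contra ntN => sNC; by rewrite -subG1 -tiNC subsetI subxx.
move=> Yb /andP[ntYb nYb] sYbN.
have nsYb : Yb <| G / C.
  by rewrite /normal nYb (subset_trans sYbN) ?quotientS ?normal_sub.
have [Y defY sCY nsYG] := inv_quotientN nsCG nsYb.
apply/eqP; rewrite eqEsubset sYbN defY quotientS //.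
apply/setIidPl; apply: minN'; rewrite ?subsetIl // normsI ?normal_norm // andbT.
apply: contra ntYb => /eqP tiNY; rewrite defY -subG1 quotient_sub1.
  have sYNC : Y \subset C * N.
    by rewrite -quotientSK ?(subset_trans (normal_sub nsYG)) ?normal_norm // -defY.
  by rewrite -(setIidPr sYNC) -group_modl // tiNY mulg1.
exact: subset_trans (normal_sub nsYG) (normal_norm nsCG).
Qed.

(** * Supplemented subgroups of index p in a minimal normal subgroup *)

Section Tau.
Variable tau : sgfun.
Hypotheses (indT : inductive_sgfun tau) (regT : Phi_regular tau).

Lemma tau_minnormal_prime (gT : finGroupType) p (G N X M R : {group gT}) :
    prime p -> minnormal N G -> N <| G -> p.-abelem N ->
    maximal X G -> ~~ (N \subset X) -> M \subset N -> #|N : M| = p ->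
    p.-Sylow(G) R -> R \subset 'N(M) ->
    (exists S : {group gT}, [/\ S \in tau G, S \subset M & U_supplement_cond S M G]) ->
  prime #|N|.
Proof.
move=> p_pr minN nsNG abelN maxX nsNX sMN iNM sylR nMR [S [tauS sSM [T [sTG defG sMT]]]].
have /mingroupP[/andP[ntN nNG] minN'] := minN.
have sNG := normal_sub nsNG; have abN := abelem_abelian abelN.
have ltMN : M \proper N.
  by rewrite properEneq sMN andbT; apply: contraTneq p_pr => eMN; rewrite -iNM eMN indexgg.
(* A trivial intersection would give [#|N * T| = #|N| * #|T|], which exceeds [#|M| * #|T|] and so
   [#|G|]. *)
have [tiNT | ntNT] := eqVneq (N :&: T) 1.
  have := subset_leq_card (mul_subG sNG sTG).
  rewrite TI_cardMg // -defG leqNgt => /negP[].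
  apply: leq_ltn_trans (_ : #|M| * #|T| < _)%N.
    by rewrite mul_cardG leq_pmulr ?cardG_gt0.
  by rewrite ltn_pmul2r ?cardG_gt0 // proper_card.
have sNT : N \subset T.
  apply/setIidPl; apply: minN'; rewrite ?subsetIl // ntNT -{1}defG mulG_subG /=.
  apply/andP; split; last by rewrite normsI ?normG ?(subset_trans sTG).
  by rewrite (subset_trans sMN) ?sub_abelian_norm ?subsetIl.
have eTG : T :=: G by rewrite -defG mulSGid // (subset_trans sMN).
have eTG' : T = G by apply: val_inj.
subst T; rewrite (setIidPl (subset_trans sMN sNG)) in sMT.
have [sNZ | nsNZ] := boolP (N \subset ZU G); first exact: minnormal_ZU_prime sNZ.
have tiNZ : N :&: ZU G = 1.
  apply/eqP; apply: contraR nsNZ => ntNZ; apply/setIidPl.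
  apply: (minN' (N :&: [group of ZU G])%G); rewrite ?subsetIl //=.
  by rewrite ntNZ normsI // norm_ZU.
(* Each [m] in [M] is [s * z] with [s] in [S] and [z] in [ZU G]; then [z] lies in
   [N :&: ZU G = 1]. *)
have eSM : S = M.
  apply: val_inj; apply/eqP; rewrite eqEsubset sSM.
  apply/subsetP=> m Mm; have /mulsgP[s z Ss Zz em] := subsetP sMT m Mm.
  have Nz : z \in N.
    by rewrite -(groupMl _ (subsetP (subset_trans sSM sMN) s Ss)) -em (subsetP sMN).
  have z1 : z \in [1 gT] by rewrite -tiNZ inE Nz.
  by rewrite em (set1P z1) mulg1.
rewrite {}eSM {S sSM sMT} in tauS.
pose C := (gcore X G)%G.
have [sXG nsGX] := andP (maxgroupp maxX).
have nsCG : C <| G := gcore_normal sXG.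
have [_ tiNX _] := minnormal_abelian_maximal minN sNG abN maxX nsNX.
have sCX : C \subset X := gcore_sub X G.
have tiNC : N :&: C = 1 by apply/trivgP; rewrite -tiNX setIS.
have nCG := normal_norm nsCG.
have primG : primitive_group (G / C)%G.
  exists (X / C)%G; split.
    by rewrite quotient_maximal // (normalS sCX sXG).
  have nsKb : gcore (X / C) (G / C) <| G / C by rewrite gcore_normal ?quotientS.
  have [K defK sCK nsKG] := inv_quotientN nsCG nsKb.
  have sKX : K \subset X.
    rewrite -(quotientSGK _ sCX) -?defK ?gcore_sub //.
    exact: subset_trans (normal_sub nsKG) nCG.
  rewrite [LHS]defK; apply/trivgP; rewrite quotient_sub1.
    by apply: gcore_max => //; apply: normal_norm.
  exact: subset_trans (normal_sub nsKG) nCG.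
have nCN := subset_trans sNG nCG; have nCM := subset_trans sMN nCN.
have pM : p.-group ((M <*> C) / C)%G.
  by rewrite /= quotientYidr // quotient_pgroup // (pgroupS sMN) ?abelem_pgroup.
have minNC := minnormal_quotient minN nsNG nsCG tiNC.
have := regT primG p_pr (indT tauS nsCG) pM minNC.
have sMCN : ((M <*> C) / C)%G \subset N / C by rewrite /= quotientYidr // quotientS.
rewrite (setIidPl sMCN) /=.
have nsCMC : C <| M <*> C.
  by rewrite /normal joing_subr join_subG nCM normG.
rewrite -quotient_subnormG // index_quotient_eq ?subsetIl //; last first.
  apply: subset_trans (subsetIr _ _) _; rewrite subsetI (normal_sub nsCG).
  exact: subset_trans (joing_subr M C) (normG _).
move=> p_iG.
(* Phi-regularity in [G / C] only controls the normaliser of [M <*> C]; since [M] is recovered as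
   [M <*> C :&: N], that normaliser also normalises [M]. *)
have sNN : 'N_G(M <*> C) \subset 'N_G(M).
  have eM : M <*> C :&: N = M.
    by rewrite norm_joinEl // -group_modl // setIC tiNC mulg1.
  by rewrite subsetI subsetIl -{2}eM normsI ?subsetIr // subIset ?nNG.
(* The index of ['N_G(M)] is a power of [p] by Phi-regularity, and prime to [p] because [R]
   normalises [M]. *)
have sGN : G \subset 'N(M).
  suff: #|G : 'N_G(M)| == 1%N by rewrite indexg_eq1 subsetI subxx.
  have p'iG : p^'.-nat #|G : 'N_G(M)|.
    have [sRG _ p'R] := and3P sylR.
    by apply: pnat_dvd p'R; rewrite indexgS // subsetI sRG.
  apply/eqP; apply: pnat_1 p'iG; apply: pnat_dvd p_iG; exact: indexgS.
(* Being normal in [G] and proper in [N], [M] must be trivial, so [#|N| = #|N : M| = p]. *)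
have [M1 | ntM] := eqVneq (M : {set gT}) 1.
  by rewrite -(indexg1 N) -M1 iNM.
by have := proper_neq ltMN; rewrite (minN' M) ?ntM // eqxx.
Qed.
End Tau.

(** * Maximal subgroups avoiding a nilpotent normal subgroup *)

Section Maximal.
Variable gT : finGroupType.
Implicit Types E G K L M N P X Y : {group gT}.

Lemma maximal_sup G X Y :
  maximal X G -> X \subset Y -> Y \subset G -> ~~ (Y \subset X) -> Y :=: G.
Proof.
move=> /maxgroupP[_ maxX] sXY sYG; apply: contraNeq => neYG.
by rewrite (maxX Y) // properEneq neYG.
Qed.

Lemma maximal_mul_normal G X N :
  maximal X G -> N <| G -> ~~ (N \subset X) -> N * X = G.
Proof.
move=> maxX /andP[sNG nNG] nsNX; have [sXG _] := andP (maxgroupp maxX).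
rewrite -norm_joinEr ?(subset_trans sXG) //.
apply: (maximal_sup maxX); rewrite ?joing_subr ?join_subG ?sNG //.
by apply: contra nsNX => /andP[].
Qed.

(** Normalisers grow in the nilpotent group [N], so the normaliser of [N :&: X] contains [X] and an
    element of [N] outside [X]; by maximality it is [G]. *)
Lemma maximal_nilpotent_normal G X N :
  maximal X G -> N <| G -> nilpotent N -> ~~ (N \subset X) -> N :&: X <| G.
Proof.
move=> maxX nsNG nilN nsNX; have [sXG _] := andP (maxgroupp maxX).
have [sNG nNG] := andP nsNG.
have prL : N :&: X \proper N by rewrite properE subsetIl subsetI subxx.
have /properP[_ [y /setIP[Ny nLy] nLy']] := nilpotent_proper_norm nilN prL.
rewrite /normal subIset ?sNG //=.
suff eN : 'N_G(N :&: X) = G by rewrite -{1}eN subsetIr.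
apply: (maximal_sup maxX); rewrite ?subsetIl //.
  by rewrite subsetI sXG normsI ?normG // (subset_trans sXG).
apply: contra nLy' => /subsetP sNX; rewrite inE Ny sNX //.
by rewrite inE (subsetP sNG).
Qed.

Lemma maximal_index_normal G X N :
  maximal X G -> N <| G -> ~~ (N \subset X) -> #|G : X| = #|N : N :&: X|.
Proof.
move=> maxX nsNG nsNX; have [sXG _] := andP (maxgroupp maxX).
have nNX := subset_trans sXG (normal_norm nsNG).
by rewrite -{1}(maximal_mul_normal maxX nsNG nsNX) -normC // indexMg indexgI.
Qed.

(** A normal [Y] of [G] with [L < Y <= N] is not inside [X], so [Y * X = G] and Dedekind's law gives
    [N = Y * L = Y]. *)
Lemma maximal_nilpotent_minnormal G X N :
    maximal X G -> N <| G -> nilpotent N -> ~~ (N \subset X) ->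
  minnormal (N / (N :&: X)) (G / (N :&: X)).
Proof.
move=> maxX nsNG nilN nsNX; set L := (N :&: X)%G.
have nsLG : L <| G := maximal_nilpotent_normal maxX nsNG nilN nsNX.
have nLG := normal_norm nsLG.
have nLN := subset_trans (normal_sub nsNG) nLG.
have sLN : L \subset N := subsetIl _ _.
apply/mingroupP; split.
  rewrite quotient_norms ?normal_norm // andbT -subG1 quotient_sub1 //.
  by rewrite subsetI subxx.
move=> Yb /andP[ntYb nYb] sYbN.
have nsYb : Yb <| G / L.
  by rewrite /normal nYb (subset_trans sYbN) ?quotientS ?normal_sub.
have [Y defY sLY nsYG] := inv_quotientN nsLG nsYb.
have sYN : Y \subset N.
  by rewrite -(quotientSGK _ sLN) -?defY // (subset_trans (normal_sub nsYG)).
have nsYX : ~~ (Y \subset X).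
  apply: contra ntYb => sYX; rewrite defY -subG1 quotient_sub1.
    by rewrite subsetI sYN.
  exact: subset_trans (normal_sub nsYG) nLG.
apply/eqP; rewrite eqEsubset sYbN defY quotientS //.
rewrite -(setIidPr (normal_sub nsNG)) -(maximal_mul_normal maxX nsYG nsYX).
by rewrite -group_modl // mul_subG // setIC.
Qed.

End Maximal.

(** * Maximal subgroups of a group with supplemented subgroups have prime index *)

Section TauMaximal.
Variable tau : sgfun.
Hypotheses (indT : inductive_sgfun tau) (regT : Phi_regular tau).

Lemma tau_maximal_index_prime (gT : finGroupType) p (G P X : {group gT}) :
    prime p -> solvable G -> P <| G -> p.-group P -> maximal X G -> ~~ (P \subset X) ->
    (forall M : {group gT}, maximal M P -> U_tau_supplemented tau M G) ->
  prime #|G : X|.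
Proof.
move=> p_pr solG nsPG pP maxX nsPX supP; have nilP := pgroup_nil pP.
pose L := (P :&: X)%G.
have nsLG : L <| G := maximal_nilpotent_normal maxX nsPG nilP nsPX.
have minN : minnormal (P / L) (G / L) := maximal_nilpotent_minnormal maxX nsPG nilP nsPX.
have nLG := normal_norm nsLG; have [sPG nPG] := andP nsPG.
have nLP := subset_trans sPG nLG; have sLP : L \subset P := subsetIl _ _.
have nsLP : L <| P by rewrite /normal sLP.
have [sXG _] := andP (maxgroupp maxX).
have nsLX : L <| X by rewrite /normal subsetIr (subset_trans sXG).
rewrite (maximal_index_normal maxX nsPG nsPX) -card_quotient //.
have nsNG : P / L <| G / L := quotient_normal L nsPG.
have pN : p.-group (P / L) := quotient_pgroup L pP.
have [_ ntN /is_abelemP[q q_pr abelN]] :=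
  minnormal_solvable minN (normal_sub nsNG) (quotient_sol L solG).
have abelNp : p.-abelem (P / L).
  have [_ pN' _] := pgroup_pdiv pN ntN.
  have /pgroupP/(_ p p_pr pN') /eqP -> := abelem_pgroup abelN.
  exact: abelN.
have maxXL : maximal (X / L) (G / L) by rewrite quotient_maximal.
have nsNX : ~~ (P / L \subset X / L) by rewrite quotientSGK ?subsetIr.
have [R sylR] := Sylow_exists p (G / L)%G.
have [sRG pR _] := and3P sylR.
have nsNR : P / L <| R.
  have sNR : P / L \subset R.
    by apply: subset_trans (pcore_sub_Hall sylR); apply: pcore_max.
  exact: normalS sNR sRG nsNG.
(* A normal subgroup of the [p]-group [R] contains normal subgroups of [R] of each smaller [p]-power
   order; lowering the exponent by one gives index [p]. *)
have [Mb [sMbN nsMbR oMb]] := normal_pgroup pR nsNR (leq_pred _).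
have iMb : #|P / L : Mb| = p.
  have lg0 : 0 < logn p #|P / L|.
    by rewrite logn_gt0 mem_primes p_pr cardG_gt0; case: (pgroup_pdiv pN ntN).
  rewrite -divgS // oMb [X in X %/ _](card_pgroup pN) -expnB ?leq_pred ?prime_gt0 //.
  by rewrite -[X in X - _](prednK lg0) subSnn.
have [M defM sLM sMP] := inv_quotientS nsLP sMbN.
have iM : #|P : M| = p.
  by rewrite -iMb defM index_quotient_eq // subIset ?sLM ?orbT.
have maxM : maximal M P by rewrite (p_index_maximal sMP) ?iM.
have prMP : M \proper P := maxgroupp maxM.
(* The core contains [L], and its image in the minimal normal [P / L] is trivial since [M] is proper
   in [P]. The supplement condition on [M] thus lives in [G / L]. *)
have gcM : gcore M G = L.
  have sLK : L \subset gcore M G by rewrite gcore_max.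
  have nsKG : gcore M G <| G by rewrite gcore_normal // (subset_trans sMP).
  have sKM : gcore M G \subset M := gcore_sub M G.
  have sKP : gcore M G \subset P := subset_trans sKM sMP.
  have nLK : gcore M G \subset 'N(L) := subset_trans sKP nLP.
  apply/eqP; rewrite eqEsubset sLK andbT -quotient_sub1 //.
  apply: contraLR prMP => ntK; rewrite properE sMP negbK.
  apply: subset_trans sKM; rewrite -(quotientSGK nLP sLK).
  have /mingroupP[_ minN'] := minN.
  rewrite -(minN' (gcore M G / L)%G) ?quotientS //= quotient_norms ?(normal_norm nsKG) // andbT.
  by rewrite -subG1.
have := supP M maxM; rewrite /U_tau_supplemented gcM => supM.
apply: (@tau_minnormal_prime tau indT regT _ p _ _ _ (M / L)%G R p_pr minN nsNG
          abelNp maxXL nsNX _ _ sylR _ supM).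
- exact: quotientS.
- by rewrite /= -defM.
- by rewrite /= -defM; apply: normal_norm.
Qed.

(** If [X] contains [E], its index is read off in [G / E]. If [X] contains ['F(E)] but not [E], then
    [[~: E, G] <= 'F(E) <= X] makes [E] normalise [X], so [X] is normal in [E * X = G]. *)
Lemma tau_supplemented_maximal_index_prime (gT : finGroupType) (G E X : {group gT}) :
    solvable G -> E <| G -> supersoluble (G / E)%G ->
    (forall (p : nat) (P M : {group gT}), prime p -> P \in 'Syl_p('F(E)) ->
       maximal M P -> U_tau_supplemented tau M G) ->
  maximal X G -> prime #|G : X|.
Proof.
move=> solG nsEG ssGE supF maxX.
have nsFG : 'F(E) <| G := char_normal_trans (Fitting_char E) nsEG.
have nilF := Fitting_nil E.
have prF (Y : {group gT}) : maximal Y G -> ~~ ('F(E) \subset Y) -> prime #|G : Y|.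
  move=> maxY nsFY.
  (* The Sylow subgroups of ['F(E)] generate it, so one of them is not in [Y]. *)
  have [P [p p_pr sylP] nsPY] : exists2 P : {group gT},
     exists2 p, prime p & p.-Sylow('F(E)) P & ~~ (P \subset Y).
    have /exists_inP[P /SylowP[p p_pr sylP] nsPY] :
        [exists (P : {group gT} | Sylow 'F(E) P), ~~ (P \subset Y)].
      apply: contraR nsFY => /exists_inPn sPY.
      have: <<\bigcup_(P : {group gT} | Sylow 'F(E) P) P>> \subset Y.
        rewrite gen_subG; apply/bigcupsP=> P sylP.
        by apply: contraR (sPY P sylP) => ->.
      by rewrite Sylow_gen.
    by exists P => //; exists p.
  have nsPG : P <| G.
    rewrite (nilpotent_Hall_pcore nilF sylP).
    exact: char_normal_trans (pcore_char _ _) nsFG.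
  apply: (tau_maximal_index_prime p_pr solG nsPG (pHall_pgroup sylP) maxY nsPY).
  by move=> M; apply: (supF p); rewrite ?inE.
have sWF : [~: E, G] \subset 'F(E).
  have nsWG : [~: E, G] <| G.
    by rewrite /normal commg_normr comm_subG ?(normal_sub nsEG).
  apply: (sub_Fitting_mod_Frattini solG nsEG nsWG).
    by rewrite commg_subl normal_norm.
  apply/bigcapsP=> Y /predU1P[-> | maxY].
    by rewrite comm_subG ?(normal_sub nsFG) ?(normal_sub nsWG).
  have [sFY | nsFY] := boolP ('F(E) \subset Y).
    apply: subset_trans sFY; rewrite commg_subl.
    by rewrite (subset_trans (normal_sub nsWG)) ?normal_norm.
  pose L := ('F(E) :&: Y)%G.
  have nsLG : L <| G := maximal_nilpotent_normal maxY nsFG nilF nsFY.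
  have nLG := normal_norm nsLG.
  have iL := maximal_index_normal maxY nsFG nsFY.
  have nLF := subset_trans (normal_sub nsFG) nLG.
  (* A group of prime order has abelian automorphism group, so the derived subgroup of [G], and with
     it [[~: E, G]], centralises ['F(E) / L]. *)
  have prL : prime #|'F(E) / L| by rewrite card_quotient //= -iL prF.
  apply: subset_trans (subsetIr 'F(E) Y); rewrite -/(gval L).
  rewrite -quotient_cents2 ?(subset_trans (normal_sub nsWG)) // centsC.
  apply: subset_trans (pm1_residual_cent_order_p prL (quotient_normal L nsFG) (erefl _)).
  apply: subset_trans (sub_gen (subsetUr _ _)).
  rewrite -quotient_der // quotientS // commSg ?normal_sub //.
have [sFX | nsFX] := boolP ('F(E) \subset X); last exact: prF.
have [sXG _] := andP (maxgroupp maxX).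
have [sEX | nsEX] := boolP (E \subset X).
  rewrite -(index_quotient_eq _ sXG (normal_norm nsEG)) ?subIset ?sEX ?orbT //.
  apply: (supersoluble_maximal_index_prime ssGE).
  by rewrite quotient_maximal // (normalS sEX sXG).
apply: maximal_normal_index_prime => //.
have nXE : E \subset 'N(X).
  rewrite -commg_subr; apply: subset_trans sFX; apply: subset_trans sWF.
  exact: commgS.
rewrite /normal sXG -(maximal_mul_normal maxX nsEG nsEX) mul_subG ?normG //.
Qed.
End TauMaximal.

(** * The characterisation of supersolubility *)

Definition triv_sgfun : sgfun := fun gT _ => [set 1%G].

Theorem theorem1p11 (gT : finGroupType) (G : {group gT}) :
  solvable G ->
  (supersoluble G <->
   exists E : {group gT},
     [/\ E <| G, supersoluble (G / E)%G &
         exists tau : sgfun,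
           [/\ is_subgroup_functor tau, inductive_sgfun tau, Phi_regular tau &
               forall (p : nat) (P M : {group gT}),
                 prime p -> P \in 'Syl_p('F(E)) -> maximal M P ->
                 U_tau_supplemented tau M G]]).
Proof.
move=> solG; split=> [ssG | [E [nsEG ssGE [tau [_ indT regT supF]]]]]; last first.
  apply: maximal_index_prime_supersoluble => // X.
  exact: tau_supplemented_maximal_index_prime supF.
(* For [E = 1] the Sylow subgroups of ['F(E)] are trivial and have no maximal subgroups, so the
   trivial functor serves. *)
exists 1%G; split; [exact: normal1 | exact: supersoluble_quotient (normal1 G) |].
exists triv_sgfun; split.
- split=> [gT' H | gT' H K | gT' rT H K f isof L sLH]; first exact: set11.
    by move/set1P->; apply: sub1G.
  have injf := isom_inj isof.
  apply/set1P/set1P=> [/(congr1 val)/= fL1 | ->]; apply: val_inj => /=.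
    by apply/eqP; rewrite -(morphim_injm_eq1 injf) // fL1.
  exact: morphim1.
- move=> gT' H N K /set1P-> nsNH; apply/set1P/val_inj.
  by rewrite /= joing1G trivg_quotient.
- move=> gT' H _ p K N p_pr /set1P-> _ _ /=.
  rewrite (setIidPl (sub1G N)) norm1 setIT indexgg //.
move=> p P M _; rewrite inE => /pHall_sub sPF maxM.
have /properP[_ [x Px ntx]] := maxgroupp maxM.
have: x \in 1%G by apply: (subsetP (Fitting_sub 1%G)); apply: (subsetP sPF).
by move/set1P=> x1; rewrite x1 group1 in ntx.
Qed.
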